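(* Let $X$ and $Y$ be topological spaces. Suppose that player two has a winning strategy in $G^\omega_1(\mathcal{O},\mathcal{O}_D)$ on $X$ and that $Y$ is separable. Then player two has a winning strategy in $G^\omega_1(\mathcal{O},\mathcal{O}_D)$ on $X\times Y$.
   Context: For a space $Z$, $G^\omega_1(\mathcal{O},\mathcal{O}_D)$ on $Z$ is the two-player game in which, at inning $n<\omega$, player one picks an open cover $\mathcal{U}_n$ of $Z$ and then player two picks an open set $U_n\in\mathcal{U}_n$. Player two wins if $\bigcup_{n<\omega}U_n$ is dense in $Z$. *)

(* Defs.v *)
From mathcomp Require Import all_boot all_order all_algebra.
From mathcomp Require Import all_classical topology.

Set Implicit Arguments.
Unset Strict Implicit.
Unset Printing Implicit Defensive.

Local Open Scope classical_set_scope.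

Definition separable (T : topologicalType) : Prop :=
  exists2 D : set T, countable D & dense D.

(* Nonemptiness only matters when [Z] is empty: it rules out the empty cover,
   to which player two would have no legal answer. *)
Definition open_cover (Z : topologicalType) (C : set (set Z)) : Prop :=
  [/\ C !=set0, C `<=` open & cover C id = setT].

(* A strategy for player two in [G^omega_1(O, O_D)] on [Z] answers the history
   [:: U_0; ...; U_n] of the moves of player one (player two's own earlier
   moves are determined by it); its values on other sequences are irrelevant. *)
Definition strategy2 (Z : topologicalType) : Type := seq (set (set Z)) -> set Z.

Definition answer (Z : topologicalType) (s : strategy2 Z)
    (U : nat -> set (set Z)) (n : nat) : set Z :=
  s (mkseq U n.+1).

Definition winning2 (Z : topologicalType) (s : strategy2 Z) : Prop :=
  forall U : nat -> set (set Z), (forall n, open_cover (U n)) ->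
    (forall n, U n (answer s U n)) /\ dense (\bigcup_n answer s U n).

Definition two_wins_G1_O_OD (Z : topologicalType) : Prop :=
  exists s : strategy2 Z, winning2 s.

(* Main.v *)
(** Let [d 0, d 1, ...] enumerate a dense subset of [Y]. Split the innings on
    [X * Y] into infinitely many infinite blocks, and during block [k] let
    player two run the strategy on [X] against the traces of the covers on the
    horizontal line at height [d k], answering with a member of the cover whose
    trace is the answer on [X]. The union of player two's moves is then dense
    on each of these lines, hence meets every nonempty open box. *)

Require Import Defs.
From mathcomp Require Import all_boot all_order all_algebra.
From mathcomp Require Import all_classical topology.

Set Implicit Arguments.
Unset Strict Implicit.
Unset Printing Implicit Defensive.

Local Open Scope classical_set_scope.

(* [n + 1 = 2 ^ k * (2 * j + 1)] makes [n] the [j]-th inning of block [k]. *)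
Definition inning (k j : nat) : nat := (2 ^ k * j.*2.+1).-1.
Definition block (n : nat) : nat := logn 2 n.+1.
Definition rank_in_block (n : nat) : nat := (n.+1 %/ 2 ^ block n)./2.

Lemma inningS k j : (inning k j).+1 = (2 ^ k * j.*2.+1)%N.
Proof. by rewrite /inning prednK// muln_gt0 expn_gt0. Qed.

Lemma block_inning k j : block (inning k j) = k.
Proof.
rewrite /block inningS lognM ?expn_gt0// pfactorK//.
by rewrite lognE /= dvdn2 /= odd_double addn0.
Qed.

Lemma rank_in_block_inning k j : rank_in_block (inning k j) = j.
Proof.
by rewrite /rank_in_block block_inning inningS mulKn ?expn_gt0//= uphalf_double.
Qed.

(** Every positive integer is a power of two times an odd number, so the blocks exhaust all innings.
    Legality of each move can thus be checked block by block. *)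
Lemma inning_block n : inning (block n) (rank_in_block n) = n.
Proof.
have [//|m + nE] := @pfactor_coprime 2 n.+1 isT; rewrite coprime2n => m_odd.
apply: succn_inj; rewrite inningS /rank_in_block /block {2}nE.
rewrite mulnK ?expn_gt0// [RHS]nE mulnC; congr (_ * _)%N.
by rewrite -[RHS]odd_double_half m_odd.
Qed.

(** Guarantees that the covers from earlier innings of a block are already in the history when a
    later inning of that block is played. *)
Lemma leq_inning k i j : (i <= j)%N -> (inning k i <= inning k j)%N.
Proof. by move=> ij; rewrite -ltnS !inningS leq_mul// ltnS leq_double. Qed.

Section product_strategy.
Variables X Y : topologicalType.

Lemma open_ysection (W : set (X * Y)) (y : Y) : open W -> open (ysection W y).
Proof.
rewrite ysectionE; apply: open_comp => x _.
by apply: cvg_pair => //; apply: cvg_cst.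
Qed.

Lemma nbhs_prod_open (W : set (X * Y)) (x : X) (y : Y) : open W -> W (x, y) ->
  exists A B, [/\ open A, open B, A x, B y & A `*` B `<=` W].
Proof.
move=> oW Wxy; have [[A B]/= [Ax By] ABW] : nbhs (x, y) W by apply: open_nbhs_nbhs.
exists A°, B°; split=> //; try exact: open_interior.
by move=> [a b] [/= Aa Bb]; apply: ABW; split; apply: interior_subset.
Qed.

Definition trace_cover (y : Y) (C : set (set (X * Y))) : set (set X) :=
  (fun W => ysection W y) @` C.

Lemma open_cover_trace (y : Y) (C : set (set (X * Y))) :
  open_cover C -> open_cover (trace_cover y C).
Proof.
move=> [[W0 CW0] Co Cc]; split; first by exists (ysection W0 y), W0.
- by move=> _ [W CW <-]; apply/open_ysection/Co.
- apply/seteqP; split=> // x _.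
  have [W CW Wxy] : cover C id (x, y) by rewrite Cc.
  by exists (ysection W y); [exists W|apply/ysectionP].
Qed.

(** At inning [n] the history has length [n.+1], hence the [.-1]. Only covers from block [k] are
    shown to [s], so each line carries its own independent play. *)
Definition line_strategy (s : strategy2 X) (d : nat -> Y) : strategy2 (X * Y)%type :=
  fun h =>
    let n := (size h).-1 in
    let k := block n in
    let V := s (mkseq (fun i => trace_cover (d k) (nth set0 h (inning k i)))
                 (rank_in_block n).+1) in
    xget set0 [set W | nth set0 h n W /\ ysection W (d k) = V].

(** Since [s] answers legally, its answer is the trace of some member of the cover, so [xget] never
    falls back on [set0]. *)
Lemma line_strategyP (s : strategy2 X) (d : nat -> Y)
    (U : nat -> set (set (X * Y))) k j :
    winning2 s -> (forall n, open_cover (U n)) ->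
  let W := answer (line_strategy s d) U (inning k j) in
  U (inning k j) W /\
  ysection W (d k) = answer s (fun i => trace_cover (d k) (U (inning k i))) j.
Proof.
move=> s_win cU /=; set V := answer s _ j.
have WV_ex : exists W, U (inning k j) W /\ ysection W (d k) = V.
  have [i|/(_ j)[W UW WV] _] := s_win (fun i => trace_cover (d k) (U (inning k i))).
    exact: open_cover_trace.
  by exists W.
suff -> : answer (line_strategy s d) U (inning k j) =
    xget set0 [set W | U (inning k j) W /\ ysection W (d k) = V].
  exact: (xgetPex set0 WV_ex).
rewrite /V /answer /line_strategy size_mkseq /= block_inning rank_in_block_inning.
rewrite nth_mkseq//; congr xget; apply/funext => W; congr (_ /\ _ = s _).
apply/eq_in_map => i; rewrite mem_iota ltnS => /andP[_ ij].
by rewrite nth_mkseq// ltnS leq_inning.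
Qed.

Lemma line_strategy_winning (s : strategy2 X) (d : nat -> Y) :
  winning2 s -> dense (range d) -> winning2 (line_strategy s d).
Proof.
move=> s_win d_dense U cU; split.
  move=> n; rewrite -(inning_block n).
  by have [] := line_strategyP d (block n) (rank_in_block n) s_win cU.
move=> O [[x y] Oxy] oO.
have [A [B [oA oB Ax By ABO]]] := nbhs_prod_open oO Oxy.
(* Choose a line whose height lies in [B]; the play of [s] along it then yields a point of [A]. *)
have [_ [/[swap] [[k _ <-]] Bdk]] := d_dense B (ex_intro _ y By) oB.
have [|_ trace_dense] := s_win (fun i => trace_cover (d k) (U (inning k i))).
  by move=> i; apply: open_cover_trace.
have [a [Aa [j _ ja]]] := trace_dense A (ex_intro _ x Ax) oA.
exists (a, d k); split; first exact: ABO.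
exists (inning k j) => //; apply/ysectionP.
by have [_ ->] := line_strategyP d k j s_win cU.
Qed.

End product_strategy.

(** Covers the case where the dense subset of [Y] is empty and has no enumeration by [nat]. Any
    legal pick wins, as density is vacuous. *)
Lemma two_wins_empty (Z : topologicalType) : (Z -> False) -> two_wins_G1_O_OD Z.
Proof.
move=> Z0; exists (fun h => xget set0 (last set0 h)) => U cU; split.
  move=> n; rewrite /answer mkseqS last_rcons.
  by have [[W UW] _ _] := cU n; apply: xgetPex; exists W.
by move=> O [z]; case: (Z0 z).
Qed.

Theorem theorem3p16 (X Y : topologicalType)
    (hX : two_wins_G1_O_OD X) (hY : separable Y) :
  two_wins_G1_O_OD (X * Y)%type.
Proof.
have [s s_win] := hX; have [D D_count D_dense] := hY.
have [D0|[d]] := pfcard_geP D_count.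
  apply: two_wins_empty => -[_ y].
  (* An empty dense set forces [Y] to be empty. *)
  by have [|z [_]] := D_dense setT _ openT; [exists y|rewrite D0].
exists (line_strategy s d); apply: line_strategy_winning => // O O0 oO.
have [y [Oy Dy]] := D_dense O O0 oO.
by exists y; split => //; apply: (@surj _ _ _ _ d).
Qed.
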